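(* Let $A=\mathrm{IDD}(K^1_\infty,0,-1)$ be the complex algebra with basis $e_1,e_2,e_3,\ldots$ and bilinear multiplication $e_i\diamond e_j=\frac{1}{j+1}e_{i+j+1}$. Then the space of derivations of $A$ is $$\mathfrak{Der}(A)=\langle\varphi_i : i\ge1\rangle,\qquad \varphi_i(e_k)=(i+k)e_{k+i-1}\quad(k\ge1).$$
   Context: A derivation of an algebra $(A,\diamond)$ is a linear map $D:A\to A$ with $D(a\diamond b)=D(a)\diamond b+a\diamond D(b)$ for all $a,b\in A$. $\langle S\rangle$ denotes the linear span (finite linear combinations) of $S$ over $\mathbb C$. *)

(* Defs.v *)
From mathcomp Require Import all_boot all_order all_algebra.
From mathcomp Require Import boolp classical_sets functions reals complex freeg.

Set Implicit Arguments.
Unset Strict Implicit.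
Unset Printing Implicit Defensive.
Import GRing.Theory.
Local Open Scope ring_scope.
Local Open Scope classical_set_scope.

Section LinearAlgebra.
Variables (K : pzRingType) (V : lmodType K).

Definition lin_span (S : set V) : set V :=
  [set v | exists (n : nat) (c : 'I_n -> K) (s : 'I_n -> V),
    (forall k, S (s k)) /\ v = \sum_(k < n) c k *: s k].

Definition Der (mul : V -> V -> V) : set (V -> V) :=
  [set D | linear D /\ forall a b, D (mul a b) = mul (D a) b + mul a (D b)].

End LinearAlgebra.

Definition posnat := {n : nat | (0 < n)%N}.

Section IDD.
Variable R : realType.

Definition IDD := {freeg posnat / R[i]}.

(* idd_e n is the n-th basis vector for n >= 1; idd_e 0 = 0 is a dummy value. *)
Definition idd_e (n : nat) : IDD :=
  oapp (fun i : posnat => << i >> : IDD) 0 (insub n).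

(* fglift f is the linear extension of a map f defined on the basis. *)
Definition idd_mul (a b : IDD) : IDD :=
  fglift (fun i : posnat => fglift (fun j : posnat =>
    ((val j).+1%:R)^-1 *: idd_e (val i + val j + 1)%N) b) a.

Definition idd_phi (i : nat) : IDD -> IDD :=
  fglift (fun k : posnat => (i + val k)%N%:R *: idd_e (val k + i - 1)%N).

Lemma fgliftE (f : posnat -> IDD) a :
  fglift f a = \sum_(z <- dom a) coeff z a *: f z.
Proof. by rewrite -{1}(Freeg_dom a) fglift_Freeg /prelift big_map. Qed.

Lemma fglift_linear (f : posnat -> IDD) : linear (fglift f).
Proof.
move=> c a b.
have fgliftB u v : fglift f (u - v) = fglift f u - fglift f v.
  exact: lift_is_additive.
have fglift0 : fglift f 0 = 0 by rewrite -[0 in LHS](subrr 0) fgliftB subrr.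
have -> : c *: a + b = c *: a - (0 - b) by rewrite sub0r opprK.
rewrite !fgliftB fglift0 sub0r opprK; congr (_ + _).
have [->|c0] := eqVneq c 0; first by rewrite !scale0r.
rewrite !fgliftE scaler_sumr (perm_big (dom a)) /=; last first.
  by apply: uniq_perm; rewrite ?uniq_dom //; exact: domZ.
by apply: eq_bigr => z _; rewrite coeffZ scalerA.
Qed.

Lemma idd_mul_linearl (b : IDD) : linear (idd_mul^~ b).
Proof. exact: fglift_linear. Qed.

Lemma idd_mul_linearr (a : IDD) : linear (idd_mul a).
Proof.
move=> c b b'; rewrite /idd_mul !fgliftE scaler_sumr -big_split /=.
apply: eq_bigr => z _.
by rewrite fglift_linear scalerDr !scalerA mulrC.
Qed.

Lemma idd_phi_linear (i : nat) : linear (idd_phi i).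
Proof. exact: fglift_linear. Qed.

Lemma idd_eE (i : posnat) : idd_e (val i) = << i >>.
Proof. by rewrite /idd_e valK. Qed.

Lemma idd_mulE (i j : nat) : (0 < i)%N -> (0 < j)%N ->
  idd_mul (idd_e i) (idd_e j) = (j.+1%:R)^-1 *: idd_e (i + j + 1)%N.
Proof.
move=> i0 j0; have := idd_eE (Sub i i0); have := idd_eE (Sub j j0).
by rewrite !SubK /idd_mul => -> ->; rewrite !liftU !scale1r.
Qed.

Lemma idd_phiE (i k : nat) : (0 < k)%N ->
  idd_phi i (idd_e k) = (i + k)%N%:R *: idd_e (k + i - 1)%N.
Proof.
move=> k0; have := idd_eE (Sub k k0).
by rewrite !SubK /idd_phi => ->; rewrite liftU scale1r.
Qed.

End IDD.

(* Main.v *)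
Require Import Defs.
From HB Require Import structures.
From mathcomp Require Import all_boot all_order all_algebra.
From mathcomp Require Import boolp classical_sets functions reals complex freeg.
From mathcomp Require Import zify ring.

(** Writing [e_k = x^k] identifies the algebra with [x C[x]], with product
    [a * int b] for the primitive [int b] vanishing at [0], and [phi_i] with the
    operator [a |-> (x^i a)'].  The Leibniz rule for the usual derivative says
    that each [phi_i] is a derivation ([idd_phi_Der]).

    Conversely, [e_1] and [e_2] generate the algebra, because
    [e_k <> e_1 = e_{k+2} / 2].  Since [phi_i e_1 = (i+1) e_i], the values
    [phi_i e_1] span the algebra, so subtracting from a derivation [D] a
    combination of the [phi_i] reduces to the case [D e_1 = 0]
    ([lin_span_phi_e1]).  Such a [D] kills [e_3 = 2 e_1 <> e_1] and
    [e_5 = 2 e_3 <> e_1].  But [e_5 = 3 e_2 <> e_2] as well, so the map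
    [x |-> x <> e_2 + e_2 <> x] kills [D e_2].  This map sends [e_m] to a
    nonzero multiple of [e_{m+3}], hence is injective, whence [D e_2 = 0] and
    [D = 0] ([Der_eq0]). *)

Set Implicit Arguments.
Unset Strict Implicit.
Unset Printing Implicit Defensive.
Import GRing.Theory Num.Theory.
Local Open Scope ring_scope.
Local Open Scope classical_set_scope.

Section LinearMaps.
Variables (K : comPzRingType) (V : lmodType K).

(** Derivations are plain functions satisfying [linear]; bundling them makes the
    theory of [{linear V -> V}] applicable. *)
Lemma linear_bundle (f : V -> V) :
  linear f -> exists g : {linear V -> V}, f = g.
Proof.
move=> lf; pose m := GRing.isLinear.Build _ _ _ _ f lf.
by exists (HB.pack_for {linear V -> V} f m).
Qed.

Lemma linear_fun0 (f : V -> V) : linear f -> f 0 = 0.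
Proof. by move=> /linear_bundle[g ->]; rewrite linear0. Qed.

Lemma linear_funZ (f : V -> V) c a : linear f -> f (c *: a) = c *: f a.
Proof. by move=> /linear_bundle[g ->]; rewrite linearZ. Qed.

Lemma linear_comb c (f g : V -> V) : linear f -> linear g -> linear (c *: f + g).
Proof.
move=> lf lg d a b.
by rewrite !fctE lf lg !scalerDr !scalerA [c * d]mulrC addrACA.
Qed.

Variable mul : V -> V -> V.
Hypotheses (mull : forall b, linear (mul^~ b)) (mulr : forall a, linear (mul a)).

Lemma Der_comb c (f g : V -> V) :
  Der mul f -> Der mul g -> Der mul (c *: f + g).
Proof.
move=> [lf df] [lg dg]; split; first exact: linear_comb.
move=> a b; rewrite !fctE df dg mull mulr scalerDr.
by rewrite addrACA.
Qed.

Lemma Der0 : Der mul 0.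
Proof.
split=> [c a b|a b]; first by rewrite /= scaler0 addr0.
by rewrite (linear_fun0 (mull b)) (linear_fun0 (mulr a)) addr0.
Qed.

Lemma lin_span_sub_Der (S : set (V -> V)) : S `<=` Der mul ->
  lin_span S `<=` Der mul.
Proof.
move=> sSD _ [n [c [s [sS ->]]]].
elim/big_ind: _ => [|f g Df Dg|k _]; first exact: Der0.
  by rewrite -[f]scale1r; exact: Der_comb.
by rewrite -[_ *: _]addr0; apply: Der_comb; [exact/sSD/sS|exact: Der0].
Qed.

End LinearMaps.

Section Idd.
Variable R : realType.
Local Notation A := (IDD R).
Local Notation e := (@idd_e R).
Local Notation mul := (@idd_mul R).
Local Notation phi := (@idd_phi R).

Lemma linear_eq (f g : A -> A) : linear f -> linear g ->
  (forall k, (0 < k)%N -> f (e k) = g (e k)) -> f = g.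
Proof.
move=> /linear_bundle[f' ->] /linear_bundle[g' ->] fg; apply/funext => a.
rewrite -(freeg_sumE a) !linear_sum; apply: eq_bigr => z _.
have -> : << coeff z a *g z >> = coeff z a *: e (val z).
  by rewrite idd_eE; apply/eqP/freeg_eqP => y; rewrite coeffZ !coeffU mul1r.
by rewrite !linearZ /= fg // (valP z).
Qed.

(** The left inverse is the linear map sending [e_{k+s}] to [c_k^-1 e_k]. *)
Lemma weighted_shift_inj (f : A -> A) (c : nat -> R[i]) (s : nat) : linear f ->
    (forall k, (0 < k)%N -> c k != 0) ->
    (forall k, (0 < k)%N -> f (e k) = c k *: e (k + s)%N) ->
  injective f.
Proof.
move=> lf c0 fE.
pose g : A -> A :=
  fglift (fun k : posnat => (c (val k - s)%N)^-1 *: e (val k - s)%N).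
have lg : linear g by exact: fglift_linear.
suff /funeqP gf : g \o f = id by apply: (can_inj (g := g)) => x; exact: gf.
apply: linear_eq => [d a b|//|k k0]; first by rewrite /= lf lg.
have ks0 : (0 < k + s)%N by rewrite addn_gt0 k0.
have gE : g (e (k + s)%N) = (c k)^-1 *: e k.
  have := idd_eE R (Sub (k + s)%N ks0); rewrite SubK => ->.
  by rewrite /g liftU scale1r /= addnK.
by rewrite /= fE // linear_funZ // gE scalerA mulfV ?scale1r ?c0.
Qed.

Lemma natS_neq0 n : (n.+1%:R : R[i]) != 0.
Proof. by rewrite pnatr_eq0. Qed.

Lemma idd_eS i j : (0 < i)%N -> (0 < j)%N ->
  e (i + j + 1)%N = j.+1%:R *: mul (e i) (e j).
Proof. by move=> i0 j0; rewrite idd_mulE // scalerA mulfV ?scale1r ?natS_neq0. Qed.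

(** Leibniz rule for [(x^i (a * int b))' = (x^i a)' * int b + a * x^i b], the
    last term being [a * int (x^i b)'].  By bilinearity it is checked on basis
    elements, where it reads
    [(i+k+l+1) / (l+1) = (i+k) / (l+1) + (i+l) / (i+l)]. *)
Lemma idd_phi_Der i : (0 < i)%N -> Der mul (phi i).
Proof.
move=> i0; split; first exact: idd_phi_linear.
have lphi := @idd_phi_linear R i.
have mull := @idd_mul_linearl R; have mulr := @idd_mul_linearr R.
move=> a b.
suff /(congr1 (@^~ a)) : (fun a => phi i (mul a b)) =
    (fun a => mul (phi i a) b + mul a (phi i b)) by [].
apply: linear_eq => [c x y|c x y|k k0].
- by rewrite mull lphi.
- by rewrite lphi !mull scalerDr addrACA.
suff /(congr1 (@^~ b)) : (fun b => phi i (mul (e k) b)) =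
    (fun b => mul (phi i (e k)) b + mul (e k) (phi i b)) by [].
apply: linear_eq => [c x y|c x y|l l0].
- by rewrite mulr lphi.
- by rewrite lphi !mulr scalerDr addrACA.
rewrite idd_mulE // !idd_phiE // (linear_funZ _ _ lphi).
rewrite (linear_funZ _ _ (mull (e l))) (linear_funZ _ _ (mulr (e k))).
rewrite idd_phiE ?idd_mulE; try lia.
have -> : (k + i - 1 + l + 1 = k + l + i)%N by lia.
have -> : (k + (l + i - 1) + 1 = k + l + i)%N by lia.
have -> : (k + l + 1 + i - 1 = k + l + i)%N by lia.
have -> : (l + i - 1).+1 = (i + l)%N by lia.
have il0 : ((i + l)%:R : R[i]) != 0 by rewrite pnatr_eq0; lia.
rewrite !scalerA -scalerDl mulfV //; congr (_ *: _).
have := natS_neq0 l; rewrite -[l.+1]addn1 !natrD => l1.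
by field.
Qed.

(** Products of copies of [e_1] yield only the [e_k] with
    [k] odd; the two factorizations of [e_5] link [D e_2] to [D e_1]. *)
Lemma Der_eq0 (D : A -> A) : Der mul D -> D (e 1) = 0 -> D = 0.
Proof.
move=> [lD dD] D1.
have mull0 b : mul 0 b = 0 by exact: linear_fun0 (@idd_mul_linearl R b).
have mulr0 a : mul a 0 = 0 by exact: linear_fun0 (@idd_mul_linearr R a).
have D_S i j : (0 < i)%N -> (0 < j)%N ->
    D (e (i + j + 1)%N) = j.+1%:R *: (mul (D (e i)) (e j) + mul (e i) (D (e j))).
  by move=> i0 j0; rewrite idd_eS // linear_funZ // dD.
have D_SS k : (0 < k)%N -> D (e k) = 0 -> D (e k.+2) = 0.
  move=> k0 Dk; have := D_S k 1%N k0 isT.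
  by rewrite Dk D1 mull0 mulr0 addr0 scaler0 !addn1.
have D2 : D (e 2) = 0.
  (* [f (D e_2)] is [D (e_2 <> e_2) = D e_5 / 3]. *)
  pose f x := mul x (e 2) + mul (e 2) x.
  have f0 : f 0 = 0 by rewrite /f mull0 mulr0 addr0.
  have lf : linear f.
    move=> c a b; rewrite /f idd_mul_linearl idd_mul_linearr scalerDr.
    by rewrite addrACA.
  pose c k : R[i] := 3%:R^-1 + k.+1%:R^-1.
  apply: (weighted_shift_inj (c := c) (s := 3) lf) => [k k0|k k0|].
  - by rewrite lt0r_neq0 // addr_gt0 // invr_gt0 ltr0n.
  - rewrite /f !idd_mulE // /c scalerDl.
    have -> : (k + 2 + 1 = k + 3)%N by lia.
    by have -> : (2 + k + 1 = k + 3)%N by lia.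
  - rewrite f0; have := D_S 2 2 isT isT.
    rewrite (D_SS 3) ?(D_SS 1) // => /esym/eqP.
    by rewrite scaler_eq0 (negPf (natS_neq0 2)) => /eqP.
apply: linear_eq => // [c a b|k]; first by rewrite /= scaler0 addr0.
elim/ltn_ind: k => -[|[|[|k]]] // IH _.
by apply: D_SS => //; exact: IH.
Qed.

(** As [phi_i e_1 = (i+1) e_i], dividing the coordinates of [a] by [i+1] gives
    the coefficients of the combination. *)
Lemma lin_span_phi_e1 (a : A) :
  exists2 f, lin_span [set phi i | i in [set i : nat | (1 <= i)%N]] f & f (e 1) = a.
Proof.
pose t := in_tuple (dom a).
pose c k := coeff (tnth t k) a / (val (tnth t k)).+1%:R.
exists (\sum_k c k *: phi (val (tnth t k))).
  exists (size (dom a)), c, (fun k => phi (val (tnth t k))); split=> // k.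
  by exists (val (tnth t k)) => //; exact: (valP (tnth t k)).
rewrite fct_sumE -[RHS]freeg_sumE (big_tnth _ _ (dom a)); apply: eq_bigr => k _.
rewrite fctE idd_phiE // addn1 add1n subn1 scalerA /c divfK ?natS_neq0 //.
by rewrite idd_eE; apply/eqP/freeg_eqP => y; rewrite coeffZ !coeffU mul1r.
Qed.

End Idd.

Theorem corollary3p7 (R : realType) :
  Der (@idd_mul R) = lin_span [set @idd_phi R i | i in [set i : nat | (1 <= i)%N]].
Proof.
have mull := @idd_mul_linearl R; have mulr := @idd_mul_linearr R.
have span_Der : lin_span [set @idd_phi R i | i in [set i : nat | (1 <= i)%N]]
    `<=` Der (@idd_mul R).
  by apply: lin_span_sub_Der => // _ [i i1 <-]; exact: idd_phi_Der.
apply/seteqP; split=> // D DD.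
have [f Sf f1] := lin_span_phi_e1 (D (idd_e R 1)).
suff : -1 *: f + D = 0 by rewrite scaleN1r addrC => /subr0_eq->.
apply: Der_eq0; first by apply: Der_comb => //; exact: span_Der.
by rewrite !fctE f1 scaleN1r addNr.
Qed.
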